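(* Let $f_0:\mathbb{R}\to\mathbb{R}$ be a smooth function that is either periodic or compactly supported, and let $f(x,v,t)$, for $x\in\mathbb{R}$, $v\in[-1,1]$, $t\ge 0$, be the solution of the free-streaming transport equation $$\partial_t f + v\,\partial_x f = 0,\qquad f(x,v,0)=f_0(x)$$ (so the initial condition is isotropic, i.e. independent of $v$), namely $f(x,v,t)=f_0(x-vt)$. For every integer $k\ge 0$ define the moment $$n_k(x,t)=\int_{-1}^{1} f(x,v,t)\,v^k\,dv .$$ Then for every integer $k\ge 0$ and every $(x,t)$ with $t>0$ and $3n_2(x,t)-n_0(x,t)\neq 0$, $$\partial_x n_{k+1} = \frac{1+(-1)^k}{2}\,\partial_x n_1 + \frac{1-(-1)^k}{2}\,\partial_x n_2 + \frac{(k+1)n_k-\frac{1+(-1)^k}{2}\,n_0-(1-(-1)^k)\,n_1}{3n_2-n_0}\,\bigl(\partial_x n_3-\partial_x n_1\bigr),$$ where all functions are evaluated at $(x,t)$.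
   Context: The moments $n_k$ are taken with respect to the monomial basis $v^k$ on $[-1,1]$. The displayed identity is called the exact closure for the free-streaming limit with isotropic initial data. *)

(* Defs.v *)
From Stdlib Require Import Reals Lra.
From Coquelicot Require Import Coquelicot.
Open Scope R_scope.

Definition smooth (g : R -> R) : Prop :=
  forall (n : nat) (x : R), ex_derive_n g n x.

Definition periodic (g : R -> R) : Prop :=
  exists T : R, 0 < T /\ forall x : R, g (x + T) = g x.

Definition compactly_supported (g : R -> R) : Prop :=
  compact (adherence (fun x => g x <> 0)).

(* Classical solutions on x in R, v in [-1,1], t >= 0; arguments in the order
   f x v t.  Since f is a total function, its values for t < 0 are irrelevant:
   the equation is required for t > 0, where f(.,v,.) is differentiable jointly
   in (x,t), and the initial value is attained continuously from t >= 0. *)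
Record free_streaming_solution (f0 : R -> R) (f : R -> R -> R -> R) : Prop := {
  fs_differentiable : forall x v t : R, -1 <= v <= 1 -> 0 < t ->
    differentiable_pt (fun y s => f y v s) x t;
  fs_transport : forall x v t : R, -1 <= v <= 1 -> 0 < t ->
    Derive (fun s => f x v s) t + v * Derive (fun y => f y v t) x = 0;
  fs_continuous0 : forall x v : R, -1 <= v <= 1 ->
    filterlim (fun p : R * R => f (fst p) v (snd p))
      (within (fun p => 0 <= snd p) (locally (x, 0)))
      (locally (f x v 0));
  fs_initial : forall x v : R, -1 <= v <= 1 -> f x v 0 = f0 x
}.

Definition moment (f : R -> R -> R -> R) (k : nat) (x t : R) : R :=
  RInt (fun v => f x v t * v ^ k) (-1) 1.

Definition dx_moment (f : R -> R -> R -> R) (k : nat) (x t : R) : R :=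
  Derive (fun y => moment f k y t) x.

(* The solution exists, is unique, and is given by the usual formula. *)
Lemma free_streaming_solutionE (f0 : R -> R) (f : R -> R -> R -> R) :
  smooth f0 ->
  free_streaming_solution f0 f <->
  (forall x v t : R, -1 <= v <= 1 -> 0 <= t -> f x v t = f0 (x - v * t)).
Proof.
intros Hs.
assert (affine : forall (g : R -> R -> R) x y lx ly,
  (forall u w, g u w = g x y + (lx * (u - x) + ly * (w - y))) ->
  differentiable_pt_lim g x y lx ly).
{ intros g x y lx ly Hg eps. exists (mkposreal 1 Rlt_0_1). intros u w _ _.
  rewrite (Hg u w).
  match goal with |- Rabs ?e <= _ => replace e with 0 by ring end.
  rewrite Rabs_R0. apply Rmult_le_pos; [left; apply cond_pos|].
  apply Rle_trans with (2 := Rmax_l _ _). apply Rabs_pos. }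
assert (Hd : forall x, ex_derive f0 x) by (intro x; exact (Hs 1%nat x)).
split.
- intros [Hdiff Htr Hc Hi] x v t Hv Ht.
  destruct (Req_dec t 0) as [-> | Ht0].
    rewrite Hi by easy. f_equal; ring.
  set (c := x - v * t).
  set (h := fun s => f (c + v * Rmax 0 s) v (Rmax 0 s)).
  assert (Hder : forall s, 0 < s -> is_derive h s 0).
  { intros s Hs0.
    apply is_derive_ext_loc with (fun s => f (c + v * s) v s).
      exists (mkposreal s Hs0); intros y Hy.
      unfold ball in Hy; simpl in Hy; unfold AbsRing_ball, abs, minus, plus, opp in Hy;
        simpl in Hy.
      apply Rabs_def2 in Hy. unfold h. rewrite Rmax_right by lra. reflexivity.
    destruct (Hdiff (c + v * s) v s Hv Hs0) as [lx [ly Hl]].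
    destruct (differentiable_pt_lim_unique _ _ _ _ _ Hl) as [E1 E2].
    pose proof (Htr (c + v * s) v s Hv Hs0) as E.
    rewrite E1, E2 in E.
    apply is_derive_Reals, differentiable_pt_lim_proj1_1 with s.
    assert (E0 : lx * v + ly * 1 = 0) by lra.
    assert (E3 : lx * 0 + ly * 0 = 0) by ring.
    rewrite <- E0 at 1. rewrite <- E3.
    apply (differentiable_pt_lim_comp (fun y s => f y v s)
             (fun u _ => c + v * u) (fun u _ => u) s s); [exact Hl | |].
    - apply affine. intros; ring.
    - apply affine. intros; ring. }
  assert (Hmax : forall s, continuous (fun s => Rmax 0 s) s).
  { intros s. apply continuous_ext with (fun s => (s + Rabs s) / 2).
      intros y. unfold Rmax, Rabs; destruct (Rle_dec 0 y), (Rcase_abs y); lra.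
    apply (continuous_mult (K := R_AbsRing) (fun s => s + Rabs s) (fun _ => / 2));
      [|apply continuous_const].
    apply (continuous_plus (V := R_NormedModule) (fun s => s) Rabs);
      [apply continuous_id | apply continuous_Rabs]. }
  assert (Hcont0 : continuous h 0).
  { unfold continuous, h.
    replace (Rmax 0 0) with 0 by (rewrite Rmax_left; lra).
    replace (c + v * 0) with c by ring.
    apply (filterlim_comp _ _ _ (fun s => (c + v * Rmax 0 s, Rmax 0 s))
             (fun p : R * R => f (fst p) v (snd p)) _
             (within (fun p => 0 <= snd p) (locally (c, 0)))); [|now apply Hc].
    intros P HP. unfold within in HP.
    assert (L : filterlim (fun s => (c + v * Rmax 0 s, Rmax 0 s)) (locally 0) (locally (c, 0))).
    { assert (K : continuous (fun s => (c + v * Rmax 0 s, Rmax 0 s)) 0).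
      { apply (continuous_comp_2 (fun s => c + v * Rmax 0 s) (fun s => Rmax 0 s) (fun a b => (a, b))).
        - apply (continuous_plus (V := R_NormedModule) (fun _ => c)); [apply continuous_const|].
          apply (continuous_mult (K := R_AbsRing) (fun _ => v));
            [apply continuous_const | apply Hmax].
        - apply Hmax.
        - apply continuous_ext with (fun u => u); [now intros []| apply continuous_id]. }
      unfold continuous in K.
      replace (Rmax 0 0) with 0 in K by (rewrite Rmax_left; lra).
      now replace (c + v * 0) with c in K by ring. }
    specialize (L _ HP). unfold filtermap in *.
    apply filter_imp with (2 := L). intros s K. apply K. apply Rmax_l. }
  destruct (MVT_gen h 0 t (fun _ => 0)) as [z [_ Hz]].
  + intros s [Hs1 _]. apply Hder. rewrite Rmin_left in Hs1 by lra. lra.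
  + intros s [Hs1 _]. rewrite Rmin_left in Hs1 by lra.
    apply continuity_pt_filterlim.
    destruct (Req_dec s 0) as [-> | Hn]; [exact Hcont0|].
    apply (ex_derive_continuous h s). exists 0. apply Hder; lra.
  + unfold h in Hz. rewrite !Rmax_right in Hz by lra.
    replace (c + v * t) with x in Hz by (unfold c; ring).
    replace (c + v * 0) with c in Hz by ring.
    rewrite (Hi c v Hv) in Hz. lra.
- intros Hf.
  assert (Hloc : forall x v t, -1 <= v <= 1 -> 0 < t ->
    differentiable_pt_lim (fun y s => f y v s) x t
      (Derive f0 (x - v * t)) (- v * Derive f0 (x - v * t))).
  { intros x v t Hv Ht.
    apply differentiable_pt_lim_ext with (fun y s => f0 (y - v * s)).
      exists (mkposreal t Ht); intros y s _ Hy; simpl in Hy.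
      apply Rabs_def2 in Hy. symmetry; apply Hf; [easy | lra].
    pose proof (Derive_correct _ _ (Hd (x - v * t))) as D.
    apply is_derive_Reals in D.
    set (d := Derive f0 (x - v * t)) in *.
    replace d with (d * 1 + 0 * 0) at 1 by ring.
    replace (- v * d) with (d * (- v) + 0 * 0) by ring.
    apply (differentiable_pt_lim_comp (fun u _ => f0 u)
             (fun y s => y - v * s) (fun _ _ => 0) x t).
    - now apply differentiable_pt_lim_proj1_0.
    - apply affine. intros; ring.
    - apply affine. intros; ring. }
  split.
  + intros x v t Hv Ht. eexists; eexists; now apply Hloc.
  + intros x v t Hv Ht.
    destruct (differentiable_pt_lim_unique _ _ _ _ _ (Hloc x v t Hv Ht)) as [E1 E2].
    rewrite E1, E2; ring.
  + intros x v Hv. rewrite Hf by (easy || lra).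
    apply filterlim_within_ext with (fun p : R * R => f0 (fst p - v * snd p)).
      intros [y s] Hs0; symmetry; now apply Hf.
    apply (filterlim_filter_le_1 (F := locally (x, 0))).
      apply filter_le_within.
    apply (continuous_comp (fun p : R * R => fst p - v * snd p) f0 (x, 0)).
    * apply (continuous_minus (V := R_NormedModule) (fun p : R * R => fst p));
        [apply continuous_fst|].
      apply (continuous_mult (K := R_AbsRing) (fun _ => v));
        [apply continuous_const | apply continuous_snd].
    * now apply (ex_derive_continuous f0).
  + intros x v Hv. rewrite Hf by (easy || lra). f_equal; ring.
Qed.

(* Main.v *)
Require Import Defs.
From Stdlib Require Import Reals Lra.
From Coquelicot Require Import Coquelicot.
Open Scope R_scope.

(** The identity is an integration by parts in [v] followed by the elimination
    of two boundary values.  The solution is [f0 (x - v t)], so that [x]- and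
    [v]-derivatives are proportional: [d/dv f0 (x - v t) = - t f0' (x - v t)].
    Integrating [d/dv (f0 (x - v t) v^(k+1))] over [-1, 1] gives, by
    [transport_moment_by_parts],
    [t dx n_(k+1) = (k+1) n_k - (a + (-1)^k b)]
    with [a = f0 (x - t)] and [b = f0 (x + t)] independent of [k].
    The cases [k = 0] and [k = 1] express [a + b] and [a - b] by [n_0], [n_1],
    [dx n_1], [dx n_2], and every [a + (-1)^k b] is one of these two; the cases
    [k = 0] and [k = 2] subtract to [t (dx n_3 - dx n_1) = 3 n_2 - n_0], which
    eliminates [t]. *)

Lemma continuous_transport (h : R -> R) (y t v : R) :
  (forall z, continuous h z) -> continuous (fun w => h (y - w * t)) v.
Proof.
intros Hh.
apply (continuous_comp (fun w => y - w * t) h); [|apply Hh].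
apply (ex_derive_continuous (fun w => y - w * t)); auto_derive; easy.
Qed.

Lemma continuous_transport_moment (h : R -> R) (k : nat) (y t v : R) :
  (forall z, continuous h z) -> continuous (fun w => h (y - w * t) * w ^ k) v.
Proof.
intros Hh.
apply (continuous_mult (K := R_AbsRing) (fun w => h (y - w * t)) (fun w => w ^ k)).
- now apply continuous_transport.
- apply (ex_derive_continuous (fun w => w ^ k)); auto_derive; easy.
Qed.

Lemma ex_RInt_transport_moment (h : R -> R) (k : nat) (y t : R) :
  (forall z, continuous h z) -> ex_RInt (fun v => h (y - v * t) * v ^ k) (-1) 1.
Proof.
intros Hh; apply (ex_RInt_continuous (V := R_CompleteNormedModule)).
intros v _; now apply continuous_transport_moment.
Qed.

(** Differentiation under the integral sign: the [x]-derivative of the integrand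
    is jointly continuous and the range of [v] is compact. *)
Lemma Derive_transport_moment (g : R -> R) (k : nat) (x t : R) :
  (forall z, ex_derive g z) -> (forall z, continuous (Derive g) z) ->
  Derive (fun y => RInt (fun v => g (y - v * t) * v ^ k) (-1) 1) x =
  RInt (fun v => Derive g (x - v * t) * v ^ k) (-1) 1.
Proof.
intros Hg Hg'.
assert (Hd : forall y v, is_derive (fun z => g (z - v * t) * v ^ k) y
                           (Derive g (y - v * t) * v ^ k)).
{ intros y v; auto_derive; [apply Hg|].
  change (fun z => g z) with g; unfold Rminus; ring. }
apply is_derive_unique.
rewrite (RInt_ext _ (fun v => Derive (fun z => g (z - v * t) * v ^ k) x)).
2: { intros v _; symmetry; apply is_derive_unique, Hd. }
apply (is_derive_RInt_param (fun y v => g (y - v * t) * v ^ k)).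
- apply filter_forall; intros y v _; exists (Derive g (y - v * t) * v ^ k); apply Hd.
- intros v _.
  apply continuity_2d_pt_ext with (fun y w => Derive g (y - w * t) * w ^ k).
    intros y w; symmetry; apply is_derive_unique, Hd.
  apply continuity_2d_pt_filterlim.
  apply (continuous_mult (K := R_AbsRing)
           (fun p : R * R => Derive g (fst p - snd p * t))
           (fun p : R * R => snd p ^ k) (x, v)).
  + apply (continuous_comp (fun p : R * R => fst p - snd p * t) (Derive g)); [|apply Hg'].
    apply (continuous_minus (V := R_NormedModule) (fun p : R * R => fst p));
      [apply continuous_fst|].
    apply (continuous_mult (K := R_AbsRing) (fun p : R * R => snd p) (fun _ => t));
      [apply continuous_snd | apply continuous_const].
  + apply (continuous_comp (fun p : R * R => snd p) (fun w => w ^ k));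
      [apply continuous_snd|].
    apply (ex_derive_continuous (fun w => w ^ k)); auto_derive; easy.
- apply filter_forall; intros y; apply ex_RInt_transport_moment.
  intros z; now apply (ex_derive_continuous g).
Qed.

(** The boundary terms of [g (x - v t) v^(k+1)] at [v = 1] and [v = -1] do not
    depend on [k] apart from the sign [(-1)^k]. *)
Lemma transport_moment_by_parts (g : R -> R) (k : nat) (x t : R) :
  (forall z, ex_derive g z) -> (forall z, continuous (Derive g) z) ->
  t * RInt (fun v => Derive g (x - v * t) * v ^ S k) (-1) 1 =
  INR (S k) * RInt (fun v => g (x - v * t) * v ^ k) (-1) 1
  - (g (x - t) + (-1) ^ k * g (x + t)).
Proof.
intros Hg Hg'.
assert (Cg : forall z, continuous g z)
  by (intros z; now apply (ex_derive_continuous g)).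
assert (Hgm := RInt_correct _ _ _ (ex_RInt_transport_moment g k x t Cg)).
assert (Hdm := RInt_correct _ _ _ (ex_RInt_transport_moment _ (S k) x t Hg')).
set (m := RInt (fun v => g (x - v * t) * v ^ k) (-1) 1) in *.
set (d := RInt (fun v => Derive g (x - v * t) * v ^ S k) (-1) 1) in *.
assert (H1 : is_RInt (fun v => INR (S k) * (g (x - v * t) * v ^ k)
                               - t * (Derive g (x - v * t) * v ^ S k)) (-1) 1
               (INR (S k) * m - t * d)).
{ apply (is_RInt_minus (V := R_NormedModule)
           (fun v => INR (S k) * (g (x - v * t) * v ^ k))
           (fun v => t * (Derive g (x - v * t) * v ^ S k)));
    now apply (is_RInt_scal (V := R_NormedModule)). }
assert (H2 : is_RInt (fun v => INR (S k) * (g (x - v * t) * v ^ k)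
                               - t * (Derive g (x - v * t) * v ^ S k)) (-1) 1
               (g (x - 1 * t) * 1 ^ S k - g (x - -1 * t) * (-1) ^ S k)).
{ apply (is_RInt_derive (V := R_CompleteNormedModule)
           (fun v => g (x - v * t) * v ^ S k)).
  - intros v _. auto_derive; [apply Hg|].
    change (fun z => g z) with g; rewrite S_INR, <- tech_pow_Rmult.
    unfold Rminus; destruct k as [|k]; simpl; ring.
  - intros v _.
    apply (continuous_minus (V := R_NormedModule)
             (fun w => INR (S k) * (g (x - w * t) * w ^ k))
             (fun w => t * (Derive g (x - w * t) * w ^ S k)));
      apply (continuous_scal_r (V := R_NormedModule));
      now apply continuous_transport_moment. }
apply (is_RInt_unique (V := R_CompleteNormedModule)) in H1.
apply (is_RInt_unique (V := R_CompleteNormedModule)) in H2.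
rewrite H2 in H1.
replace (x - 1 * t) with (x - t) in H1 by ring.
replace (x - -1 * t) with (x + t) in H1 by ring.
rewrite pow1 in H1; simpl ((-1) ^ S k) in H1.
lra.
Qed.

Lemma free_streaming_moment (f0 : R -> R) (f : R -> R -> R -> R)
    (k : nat) (x t : R) :
  smooth f0 -> free_streaming_solution f0 f -> 0 <= t ->
  moment f k x t = RInt (fun v => f0 (x - v * t) * v ^ k) (-1) 1.
Proof.
intros Hs Hf Ht; apply RInt_ext; intros v [Hv1 Hv2].
rewrite Rmin_left in Hv1 by lra; rewrite Rmax_right in Hv2 by lra.
rewrite (proj1 (free_streaming_solutionE f0 f Hs) Hf) by lra.
reflexivity.
Qed.

Lemma dx_moment_free_streaming (f0 : R -> R) (f : R -> R -> R -> R)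
    (k : nat) (x t : R) :
  smooth f0 -> free_streaming_solution f0 f -> 0 <= t ->
  t * dx_moment f (S k) x t =
  INR (S k) * moment f k x t - (f0 (x - t) + (-1) ^ k * f0 (x + t)).
Proof.
intros Hs Hf Ht.
assert (Hd : forall z, ex_derive f0 z) by (intros z; exact (Hs 1%nat z)).
assert (Hc : forall z, continuous (Derive f0) z)
  by (intros z; apply (ex_derive_continuous (Derive f0)), (Hs 2%nat z)).
unfold dx_moment.
rewrite (Derive_ext _ (fun y => RInt (fun v => f0 (y - v * t) * v ^ S k) (-1) 1))
  by (intros y; now apply free_streaming_moment).
rewrite (free_streaming_moment f0 f k x t Hs Hf Ht).
rewrite Derive_transport_moment by easy.
now apply transport_moment_by_parts.
Qed.

Theorem mainTheorem1 :
  forall (f0 : R -> R) (f : R -> R -> R -> R),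
    smooth f0 ->
    periodic f0 \/ compactly_supported f0 ->
    free_streaming_solution f0 f ->
    forall (k : nat) (x t : R),
      0 < t ->
      3 * moment f 2 x t - moment f 0 x t <> 0 ->
      dx_moment f (k + 1) x t =
        (1 + (-1) ^ k) / 2 * dx_moment f 1 x t
        + (1 - (-1) ^ k) / 2 * dx_moment f 2 x t
        + (INR (k + 1) * moment f k x t
           - (1 + (-1) ^ k) / 2 * moment f 0 x t
           - (1 - (-1) ^ k) * moment f 1 x t)
          / (3 * moment f 2 x t - moment f 0 x t)
          * (dx_moment f 3 x t - dx_moment f 1 x t).
Proof.
intros f0 f Hs _ Hf k x t Ht Hne.
replace (k + 1)%nat with (S k) by (now rewrite Nat.add_1_r).
assert (E := fun j => dx_moment_free_streaming f0 f j x t Hs Hf (Rlt_le _ _ Ht)).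
assert (Ek := E k); assert (E0 := E 0%nat).
assert (E1 := E 1%nat); assert (E2 := E 2%nat).
replace (INR 1) with 1 in E0 by (simpl; ring).
replace (INR 2) with 2 in E1 by (simpl; ring).
replace (INR 3) with 3 in E2 by (simpl; ring).
replace ((-1) ^ 0) with 1 in E0 by ring.
replace ((-1) ^ 1) with (-1) in E1 by ring.
replace ((-1) ^ 2) with 1 in E2 by ring.
assert (E3 : dx_moment f 3 x t - dx_moment f 1 x t
             = (3 * moment f 2 x t - moment f 0 x t) / t).
{ apply Rmult_eq_reg_l with t; [|lra].
  rewrite Rmult_minus_distr_l, E2, E0; field; lra. }
rewrite E3.
apply Rmult_eq_reg_l with t; [|lra].
rewrite Ek.
(* a + s b = (1 + s)/2 (a + b) + (1 - s)/2 (a - b) for any s, so the parity of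
   [k] need not be examined. *)
set (s := (-1) ^ k) in *.
set (D1 := dx_moment f 1 x t) in *; set (D2 := dx_moment f 2 x t) in *.
transitivity ((1 + s) / 2 * (t * D1) + (1 - s) / 2 * (t * D2)
  + (INR (S k) * moment f k x t - (1 + s) / 2 * moment f 0 x t
     - (1 - s) * moment f 1 x t)).
- rewrite E0, E1; field.
- field; split; [lra | exact Hne].
Qed.
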